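(* Suppose $\gamma\in(0,2]$ and $\kappa>\max\{4\gamma^{-1}-1,\ 3+2\sqrt2\}$. Consider the map $\mathcal{F}_\gamma$ of the state $s=(x,y,\alpha)\in\mathbb{R}^3$ defined (wherever the denominators are nonzero) by $$\mathcal{F}_\gamma(s)=\begin{pmatrix}\dfrac{(1-\alpha\kappa)x}{\sqrt{(1-\alpha\kappa)^2x^2+(1-\alpha)^2y^2}}\\[3mm] \dfrac{(1-\alpha)y}{\sqrt{(1-\alpha\kappa)^2x^2+(1-\alpha)^2y^2}}\\[3mm] \dfrac{\gamma}{2}\cdot\dfrac{\kappa(1-\alpha\kappa)^2x^2+(1-\alpha)^2y^2}{\kappa^2(1-\alpha\kappa)^2x^2+(1-\alpha)^2y^2}\end{pmatrix}.$$ Then the dynamical system $s^+=\mathcal{F}_\gamma(s)$ has period-two orbits given by $$\mathcal{S}=\left\{(s_1,s_2):\ s_1=\big(x,y,\tfrac{2}{\kappa+1}\big),\ s_2=\big(-x,y,\tfrac{2}{\kappa+1}\big),\ x^2=\frac{\gamma(\kappa+1)-4}{(4-\gamma)(\kappa^2-1)},\ y^2=\frac{\kappa(\gamma-4\kappa+\gamma\kappa)}{(\gamma-4)(\kappa^2-1)}\right\},$$ i.e. $\mathcal{F}_\gamma(s_1)=s_2$ and $\mathcal{F}_\gamma(s_2)=s_1$ for all $(s_1,s_2)\in\mathcal{S}$. Moreover, with $N=(x-\alpha\kappa x)^2+(y-\alpha y)^2$ and $M=\kappa^2x^2(\alpha\kappa-1)^2+(\alpha-1)^2y^2$, the Jacobian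 of $\mathcal{F}_\gamma$ at $s=(x,y,\alpha)$ is $$\mathcal{J}_{\mathcal{F}_\gamma}(s)=\begin{pmatrix} -\dfrac{(\alpha-1)^2y^2(\alpha\kappa-1)}{N^{3/2}} & \dfrac{(\alpha-1)^2xy(\alpha\kappa-1)}{N^{3/2}} & \dfrac{(\alpha-1)(\kappa-1)xy^2}{N^{3/2}}\\[3mm] \dfrac{(\alpha-1)xy(\alpha\kappa-1)^2}{N^{3/2}} & -\dfrac{(\alpha-1)x^2(\alpha\kappa-1)^2}{N^{3/2}} & -\dfrac{(\kappa-1)x^2y(\alpha\kappa-1)}{N^{3/2}}\\[3mm] -\dfrac{(\alpha-1)^2\gamma(\kappa-1)\kappa xy^2(\alpha\kappa-1)^2}{M^2} & \dfrac{(\alpha-1)^2\gamma(\kappa-1)\kappa x^2y(\alpha\kappa-1)^2}{M^2} & \dfrac{(\alpha-1)\gamma(\kappa-1)^2\kappa x^2y^2(\alpha\kappa-1)}{M^2} \end{pmatrix}.$$ In particular, for any $(s_1,s_2)\in\mathcal{S}$ (the set $\mathcal{S}$ being taken for the corresponding value of $\gamma$), the spectral radius $\rho(\cdot)$ of the product of Jacobians satisfies, for $\gamma=1$, $$\rho\big(\mathcal{J}_{\mathcal{F}_1}(s_1)\,\mathcal{J}_{\mathcal{F}_1}(s_2)\big)=\frac{4(\kappa^2-4\kappa+1)^2}{(\kappa-1)^4}>1,$$ and, for $\gamma=2$, $$\rho\big(\mathcal{J}_{\mathcal{F}_2}(s_1)\,\mathcal{J}_{\mathcal{F}_2}(s_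2)\big)=1.$$
   Context: The spectral radius of a square matrix is the maximum modulus of its (complex) eigenvalues. The map $\mathcal{F}_\gamma$ describes gradient descent with $\gamma$ times the Polyak stepsize on $q(x,y)=\frac{\kappa}{2}x^2+\frac12y^2$, with state equal to the normalized iterate together with the current effective stepsize $\alpha$. *)

(* Defs.v *)
From HB Require Import structures.
From mathcomp Require Import all_boot all_order all_algebra.
From mathcomp Require Import complex.
From mathcomp Require Import all_classical all_reals all_analysis.

Set Implicit Arguments.
Unset Strict Implicit.
Unset Printing Implicit Defensive.

Import Order.TTheory GRing.Theory Num.Theory.
Import numFieldNormedType.Exports.
Local Open Scope classical_set_scope.
Local Open Scope ring_scope.

Section SpectralRadius.
Variable R : realType.

Definition eigenvalue_moduli n (A : 'M[R]_n) : set R :=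
  [set ComplexField.Normc.normc l | l in
     [set l : R[i] | eigenvalue (map_mx (real_complex R) A) l]].

(* The supremum is a maximum as soon as 0 < n: see spectral_radius_max. *)
Definition spectral_radius n (A : 'M[R]_n) : R := sup (eigenvalue_moduli A).

Lemma spectral_radius_max n (A : 'M[R]_n) : (0 < n)%N ->
  eigenvalue_moduli A (spectral_radius A) /\
  (forall r, eigenvalue_moduli A r -> r <= spectral_radius A).
Proof.
move=> n_gt0; pose B := map_mx (real_complex R) A.
have [a aB] := eigenvalue_closed B n_gt0.
have [rs rsE] := closed_field_poly_normal (char_poly B).
have mem_rs l : (l \in rs) = eigenvalue B l.
  rewrite eigenvalue_root_char rsE (monicP (char_poly_monic B)) scale1r.
  by rewrite root_prod_XsubC.
have [m mrs mP] : exists2 m, m \in rs &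
    forall l, l \in rs ->
      ComplexField.Normc.normc l <= ComplexField.Normc.normc m.
  have : rs != [::] by apply: contraTneq aB => rs0; rewrite -mem_rs rs0.
  elim: rs {rsE mem_rs} => // x s IHs _.
  have [-> | /IHs[m ms mP]] := eqVneq s [::].
    by exists x => [|l]; rewrite ?mem_head // inE => /eqP ->.
  have [xm | mx] := leP (ComplexField.Normc.normc x) (ComplexField.Normc.normc m).
    by exists m => [|l]; rewrite ?inE ?ms ?orbT // => /predU1P[-> | /mP].
  exists x => [|l]; rewrite ?mem_head // inE => /predU1P[-> // | /mP].
  by move=> /le_trans; apply; exact: ltW.
have mA : eigenvalue_moduli A (ComplexField.Normc.normc m).
  by rewrite mem_rs in mrs; exists m; first exact: mrs.
have ubA : ubound (eigenvalue_moduli A) (ComplexField.Normc.normc m).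
  by move=> _ [l lB <-]; apply: mP; rewrite mem_rs; exact: lB.
suff -> : spectral_radius A = ComplexField.Normc.normc m by [].
apply/eqP; rewrite eq_le; apply/andP; split.
  by apply: ge_sup => //; exists (ComplexField.Normc.normc m).
by apply: ub_le_sup => //; exists (ComplexField.Normc.normc m).
Qed.

End SpectralRadius.

Section PolyakMap.
Variable R : realType.

(* [jacobian] acts on row vectors from the right, so its (i, j) entry is the
   derivative of the j-th component along the i-th coordinate; the usual
   Jacobian matrix is its transpose. *)
Definition Jac n m (f : 'rV[R]_n -> 'rV[R]_m) (s : 'rV[R]_n) : 'M[R]_(m, n) :=
  (jacobian f s)^T.

Definition vec3 (x y z : R) : 'rV[R]_3 := \row_i nth 0 [:: x; y; z] i.

Definition mat3 (a00 a01 a02 a10 a11 a12 a20 a21 a22 : R) : 'M[R]_3 :=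
  \matrix_(i, j) nth 0 (nth [::] [:: [:: a00; a01; a02];
                                     [:: a10; a11; a12];
                                     [:: a20; a21; a22]] i) j.

Variables gamma kappa : R.

Definition F_den12 (s : 'rV[R]_3) : R :=
  let x := s 0 0 in let y := s 0 1 in let alpha := s 0 2 in
  Num.sqrt ((1 - alpha * kappa) ^+ 2 * x ^+ 2 + (1 - alpha) ^+ 2 * y ^+ 2).

Definition F_den3 (s : 'rV[R]_3) : R :=
  let x := s 0 0 in let y := s 0 1 in let alpha := s 0 2 in
  kappa ^+ 2 * (1 - alpha * kappa) ^+ 2 * x ^+ 2 + (1 - alpha) ^+ 2 * y ^+ 2.

Definition F_dom : set 'rV[R]_3 :=
  [set s | F_den12 s != 0 /\ F_den3 s != 0].

Definition F (s : 'rV[R]_3) : 'rV[R]_3 :=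
  let x := s 0 0 in let y := s 0 1 in let alpha := s 0 2 in
  vec3 ((1 - alpha * kappa) * x / F_den12 s)
       ((1 - alpha) * y / F_den12 s)
       (gamma / 2 *
         ((kappa * (1 - alpha * kappa) ^+ 2 * x ^+ 2 + (1 - alpha) ^+ 2 * y ^+ 2)
          / F_den3 s)).

Definition orbits2 : set ('rV[R]_3 * 'rV[R]_3) :=
  [set p | exists x y : R,
    [/\ p.1 = vec3 x y (2 / (kappa + 1)),
        p.2 = vec3 (- x) y (2 / (kappa + 1)),
        x ^+ 2 = (gamma * (kappa + 1) - 4) / ((4 - gamma) * (kappa ^+ 2 - 1)) &
        y ^+ 2 = kappa * (gamma - 4 * kappa + gamma * kappa)
                 / ((gamma - 4) * (kappa ^+ 2 - 1))]].

Definition JF_formula (s : 'rV[R]_3) : 'M[R]_3 :=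
  let x := s 0 0 in let y := s 0 1 in let alpha := s 0 2 in
  let N := (x - alpha * kappa * x) ^+ 2 + (y - alpha * y) ^+ 2 in
  let M := kappa ^+ 2 * x ^+ 2 * (alpha * kappa - 1) ^+ 2
           + (alpha - 1) ^+ 2 * y ^+ 2 in
  let N32 := N `^ (3 / 2) in
  mat3
    (- ((alpha - 1) ^+ 2 * y ^+ 2 * (alpha * kappa - 1) / N32))
    ((alpha - 1) ^+ 2 * x * y * (alpha * kappa - 1) / N32)
    ((alpha - 1) * (kappa - 1) * x * y ^+ 2 / N32)
    ((alpha - 1) * x * y * (alpha * kappa - 1) ^+ 2 / N32)
    (- ((alpha - 1) * x ^+ 2 * (alpha * kappa - 1) ^+ 2 / N32))
    (- ((kappa - 1) * x ^+ 2 * y * (alpha * kappa - 1) / N32))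
    (- ((alpha - 1) ^+ 2 * gamma * (kappa - 1) * kappa * x * y ^+ 2
        * (alpha * kappa - 1) ^+ 2 / M ^+ 2))
    ((alpha - 1) ^+ 2 * gamma * (kappa - 1) * kappa * x ^+ 2 * y
        * (alpha * kappa - 1) ^+ 2 / M ^+ 2)
    ((alpha - 1) * gamma * (kappa - 1) ^+ 2 * kappa * x ^+ 2 * y ^+ 2
        * (alpha * kappa - 1) / M ^+ 2).

End PolyakMap.

(* Main.v *)
(**
Up to its third coordinate, [F] normalizes the gradient step
[(u, w) = ((1 - alpha kappa) x, (1 - alpha) y)], and the third coordinate is
homogeneous of degree zero in [(u, w)].  Hence [F] depends on the direction of
[(u, w)] only and each Jacobian has rank one, [J(s) = u(s) *m v(s)].  The product
of two of them is again of rank one, so its spectral radius is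
[|v(s1) u(s2)| * |v(s2) u(s1)|].  At [alpha = 2 / (kappa + 1)] the step is
[c (-x, y)] with [c = (kappa - 1) / (kappa + 1)]; together with
[x^2 + y^2 = 1] and [kappa^2 x^2 + y^2 = kappa gamma / (4 - gamma)] this gives
both the period-two orbit and the value of the two scalar products.
*)
Require Import Defs.
From HB Require Import structures.
From mathcomp Require Import all_boot all_order all_algebra.
From mathcomp Require Import complex.
From mathcomp Require Import all_classical all_reals all_analysis.
From mathcomp Require Import ring lra.
Import Order.TTheory GRing.Theory Num.Theory.
Import numFieldNormedType.Exports.
Local Open Scope classical_set_scope.
Local Open Scope ring_scope.

Set Implicit Arguments.
Unset Strict Implicit.

(** * Spectral radius of a rank-one matrix *)

Section RankOneSpectrum.
Variables (R : realType) (n : nat).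
Implicit Types (u : 'cV[R]_n) (v : 'rV[R]_n).

(** An eigenvector [w] for [l != 0] is proportional to [v], since [(w u) v = l w]; multiplying by
    [u] on the right and cancelling the nonzero scalar [w u] gives [l = v u]. *)
Lemma eigenvalue_mul_col_row (K : fieldType) (u : 'cV[K]_n) (v : 'rV[K]_n) l :
  eigenvalue (u *m v) l -> l = 0 \/ l = (v *m u) 0 0.
Proof.
move=> /eigenvalueP[w wuv w_neq0]; have [->|l_neq0] := eqVneq l 0; first by left.
right; set c := (w *m u) 0 0.
have cv : c *: v = l *: w.
  by rewrite -wuv mulmxA [w *m u]mx11_scalar mul_scalar_mx.
have c_neq0 : c != 0.
  apply: contra_neq w_neq0 => c0; apply/eqP; move: cv.
  by rewrite c0 scale0r => /esym/eqP; rewrite scaler_eq0 (negPf l_neq0).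
have : c *: (v *m u) = l *: (w *m u) by rewrite !scalemxAl cv.
by move=> /matrixP/(_ 0 0); rewrite mxE [RHS]mxE mulrC => /(mulIf c_neq0).
Qed.

Lemma spectral_radius_mul_col_row u v : (0 < n)%N ->
  spectral_radius (u *m v) = `|(v *m u) 0 0|.
Proof.
move=> n_gt0; have [[l le lr] ub] := spectral_radius_max (u *m v) n_gt0.
have normcE (x : R) : ComplexField.Normc.normc (x%:C)%C = `|x|.
  by rewrite /= expr0n /= addr0 sqrtr_sqr.
have normc0 : ComplexField.Normc.normc (0 : R[i]) = 0 by rewrite normcE normr0.
have vuE : (map_mx (real_complex R) v *m map_mx (real_complex R) u) 0 0
    = (((v *m u) 0 0)%:C)%C by rewrite -map_mxM mxE.
(* If [v u = 0], then [v] may vanish and is no eigenvector in general, but 0 is then the only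
   possible eigenvalue. Otherwise [v] itself is an eigenvector for [v u]. *)
have [vu0|vu0] := eqVneq ((v *m u) 0 0) 0.
  move: le; rewrite /= map_mxM => /eigenvalue_mul_col_row; rewrite vuE vu0.
  by case=> l0; rewrite -lr l0 normcE.
apply/eqP; rewrite eq_le; apply/andP; split.
  move: le; rewrite /= map_mxM => /eigenvalue_mul_col_row; rewrite vuE -lr.
  by case=> ->; rewrite ?normc0 ?normcE.
apply: ub; exists (((v *m u) 0 0)%:C)%C; last exact: normcE.
apply/eigenvalueP; exists (map_mx (real_complex R) v).
  by rewrite map_mxM mulmxA [_ *m map_mx _ u]mx11_scalar mul_scalar_mx vuE.
apply: contra_neq vu0 => v0.
have : (((v *m u) 0 0)%:C)%C = 0 by rewrite -vuE v0 mul0mx mxE.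
by move=> /complexI.
Qed.

End RankOneSpectrum.

(** * Differentials of coordinates, inverses, square roots and vectors given by components *)

Section Differentials.
Variable R : realType.

Lemma is_diff_ext (V W : normedModType R) (f g df dg : V -> W) (s : V) :
  f =1 g -> df =1 dg -> is_diff s f df -> is_diff s g dg.
Proof. by move=> /funext <- /funext <-. Qed.

Lemma is_diff_coord m n (s : 'M[R]_(m, n)) i j :
  is_diff s (fun u : 'M[R]_(m, n) => u i j : R) (fun u => u i j).
Proof.
apply: DiffDef; first exact: differentiable_coord.
apply/funext => v; rewrite -deriveE; last exact: differentiable_coord.
have dv : derivable (@id 'M[R]_(m, n)) s v by exact: derivable_id.
by have := derive_mx dv; rewrite derive_id => /matrixP/(_ i j); rewrite mxE.
Qed.

Section RealValued.
Variables (V : normedModType R) (f df : V -> R) (s : V).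
Hypothesis dfs : is_diff s f df.

Lemma is_diffV : f s != 0 ->
  is_diff s (fun u => (f u)^-1) (fun v => - (f s) ^- 2 * df v).
Proof.
move=> fs0; apply: DiffDef; first exact: differentiableV.
by rewrite diffV // diff_val.
Qed.

Lemma is_diff_sqrt : 0 < f s ->
  is_diff s (fun u => Num.sqrt (f u)) (fun v => df v / (2 * Num.sqrt (f s))).
Proof.
move=> fs0; have [dsqrt sqrtE] := is_derive1_sqrt fs0.
have sqrt_diff : is_diff (f s) Num.sqrt ( *:%R ^~ (2 * Num.sqrt (f s))^-1).
  apply: DiffDef; first exact/derivable1_diffP.
  by rewrite deriv1E // derive1E sqrtE.
exact: is_diff_comp.
Qed.

Lemma is_diffZl (W : normedModType R) (w : W) :
  is_diff s (fun u => f u *: w) (fun v => df v *: w).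
Proof.
apply: DiffDef; first exact: differentiableZl.
by rewrite diffZl // diff_val.
Qed.

End RealValued.

Lemma vec3_sum (a b c : R) :
  vec3 a b c = a *: vec3 1 0 0 + b *: vec3 0 1 0 + c *: vec3 0 0 1.
Proof.
by apply/rowP => -[[|[|[|//]]] ?]; rewrite !mxE /= !(mulr0, mulr1, addr0, add0r).
Qed.

Lemma is_diff_vec3 (V : normedModType R) (f g h df dg dh : V -> R) (s : V) :
  is_diff s f df -> is_diff s g dg -> is_diff s h dh ->
  is_diff s (fun u => vec3 (f u) (g u) (h u)) (fun v => vec3 (df v) (dg v) (dh v)).
Proof.
move=> /is_diffZl/(_ _ (vec3 1 0 0)) df' /is_diffZl/(_ _ (vec3 0 1 0)) dg'.
move=> /is_diffZl/(_ _ (vec3 0 0 1)) dh'.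
apply: is_diff_ext (is_diffD (is_diffD df' dg') dh') => u /=;
  by rewrite [RHS]vec3_sum.
Qed.

End Differentials.

Lemma sum_ord3 (V : nmodType) (f : 'I_3 -> V) : \sum_i f i = f 0 + f 1 + f 2.
Proof.
rewrite !big_ord_recl big_ord0 addr0 addrA.
by congr (_ + f _ + f _); apply: val_inj.
Qed.

(** * Rank-one differential of [F] and its Jacobian matrix *)

Section PolyakDifferential.
Variables (R : realType) (gamma kappa : R).
Implicit Types s : 'rV[R]_3.

Definition ustep s : R := (1 - s 0 2 * kappa) * s 0 0.
Definition wstep s : R := (1 - s 0 2) * s 0 1.

Lemma F_stepE s : F gamma kappa s =
  vec3 (ustep s / F_den12 kappa s) (wstep s / F_den12 kappa s)
    (gamma / 2 * ((kappa * ustep s ^+ 2 + wstep s ^+ 2) / F_den3 kappa s)).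
Proof. by rewrite /F /= !exprMn !mulrA. Qed.

Lemma F_den12_stepE s : F_den12 kappa s = Num.sqrt (ustep s ^+ 2 + wstep s ^+ 2).
Proof. by rewrite /F_den12 !exprMn. Qed.

Lemma F_den3_stepE s : F_den3 kappa s = kappa ^+ 2 * ustep s ^+ 2 + wstep s ^+ 2.
Proof. by rewrite /F_den3 !exprMn !mulrA. Qed.

(* The image of F only depends on the direction of (ustep, wstep), so its
   differential has rank one: it is the linear form
   [wstep * d ustep - ustep * d wstep] times the fixed vector [dF_dir]. *)
Definition dF_dir s : 'rV[R]_3 :=
  vec3 (wstep s / F_den12 kappa s ^+ 3) (- ustep s / F_den12 kappa s ^+ 3)
    (- (gamma * kappa * (kappa - 1) * ustep s * wstep s / F_den3 kappa s ^+ 2)).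

Definition dF_form s : 'rV[R]_3 :=
  vec3 (wstep s * (1 - s 0 2 * kappa)) (- ustep s * (1 - s 0 2))
    (ustep s * s 0 1 - wstep s * kappa * s 0 0).

(** The two parentheses are the differentials of [ustep] and [wstep] at [s] along [v]. *)
Lemma dF_form_mulr s (v : 'rV[R]_3) : (dF_form s *m v^T) 0 0 =
  wstep s * ((1 - s 0 2 * kappa) * v 0 0 - kappa * s 0 0 * v 0 2)
  - ustep s * ((1 - s 0 2) * v 0 1 - s 0 1 * v 0 2).
Proof.
by rewrite mxE sum_ord3 !mxE /=; ring.
Qed.

(** Strict positivity is what makes the square root in [F_den12] differentiable. *)
Lemma F_dom_gt0 s : F_dom kappa s -> 0 < ustep s ^+ 2 + wstep s ^+ 2.
Proof.
move=> [+ _]; rewrite F_den12_stepE => D0; rewrite lt_neqAle.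
rewrite addr_ge0 ?sqr_ge0 // andbT eq_sym.
by apply: contra_neq D0 => ->; rewrite sqrtr0.
Qed.

Lemma is_diff_F s : F_dom kappa s ->
  is_diff s (F gamma kappa) (fun v => (dF_form s *m v^T) 0 0 *: dF_dir s).
Proof.
move=> sdom; have N_gt0 := F_dom_gt0 sdom.
have [D_neq0 M_neq0] := sdom.
have D2 : F_den12 kappa s ^+ 2 = ustep s ^+ 2 + wstep s ^+ 2.
  by rewrite F_den12_stepE sqr_sqrtr // ltW.
pose du (v : 'rV[R]_3) : R := (1 - s 0 2 * kappa) * v 0 0 - kappa * s 0 0 * v 0 2.
pose dw (v : 'rV[R]_3) : R := (1 - s 0 2) * v 0 1 - s 0 1 * v 0 2.
have udiff : is_diff s ustep du.
  have d0 := is_diff_coord s 0 0; have d2 := is_diff_coord s 0 2.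
  have c (a : R) : is_diff s (cst a) (fun=> 0) := is_diff_cst a s.
  apply: is_diff_ext (is_diffM (is_diffB (c 1) (is_diffM d2 (c kappa))) d0) => v //=.
  by rewrite /du !fctE /= /GRing.scale /=; ring.
have wdiff : is_diff s wstep dw.
  have d1 := is_diff_coord s 0 1; have d2 := is_diff_coord s 0 2.
  have c1 : is_diff s (cst (1 : R)) (fun=> 0) := is_diff_cst (1 : R) s.
  apply: is_diff_ext (is_diffM (is_diffB c1 d2) d1) => v //=.
  by rewrite /dw !fctE /= /GRing.scale /=; ring.
have u2diff : is_diff s (fun v => ustep v ^+ 2) (fun v => 2 * ustep s * du v).
  by apply: is_diff_ext (is_diffM udiff udiff) => v /=;
    rewrite !fctE /= /GRing.scale /=; ring.
have w2diff : is_diff s (fun v => wstep v ^+ 2) (fun v => 2 * wstep s * dw v).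
  by apply: is_diff_ext (is_diffM wdiff wdiff) => v /=;
    rewrite !fctE /= /GRing.scale /=; ring.
have Ddiff : is_diff s (F_den12 kappa)
    (fun v => (ustep s * du v + wstep s * dw v) / F_den12 kappa s).
  apply: is_diff_ext (is_diff_sqrt (is_diffD u2diff w2diff) N_gt0) => v /=.
    by rewrite F_den12_stepE.
  rewrite !fctE -F_den12_stepE; field; exact: D_neq0.
have Mdiff : is_diff s (F_den3 kappa)
    (fun v => 2 * (kappa ^+ 2 * ustep s * du v + wstep s * dw v)).
  apply: is_diff_ext (is_diffD (is_diffZ (kappa ^+ 2) u2diff) w2diff) => v /=.
    by rewrite F_den3_stepE.
  by rewrite !fctE /= /GRing.scale /=; ring.
have DVdiff := is_diffV Ddiff D_neq0; have MVdiff := is_diffV Mdiff M_neq0.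
have Qdiff := is_diffM (is_diffD (is_diffZ kappa u2diff) w2diff) MVdiff.
(* Over the common denominator [D^3], replacing [D^2] by [u^2 + w^2] cancels terms: [d(u/D)] becomes
   [w (w du - u dw) / D^3], and similarly for [w/D]. *)
have D3E a b : a / F_den12 kappa s - b / F_den12 kappa s ^+ 3 =
    (a * (ustep s ^+ 2 + wstep s ^+ 2) - b) / F_den12 kappa s ^+ 3.
  by rewrite -D2; field.
apply: is_diff_ext (is_diff_vec3 (is_diffM udiff DVdiff)
  (is_diffM wdiff DVdiff) (is_diffZ (gamma / 2) Qdiff)) => v /=.
  by rewrite F_stepE.
rewrite dF_form_mulr -/(du v) -/(dw v).
apply/rowP => -[[|[|[|//]]] ?]; rewrite !mxE /= !fctE /= /GRing.scale /=.
- transitivity (du v / F_den12 kappa s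
      - ustep s * (ustep s * du v + wstep s * dw v) / F_den12 kappa s ^+ 3).
    by field.
  by rewrite D3E; ring.
- transitivity (dw v / F_den12 kappa s
      - wstep s * (ustep s * du v + wstep s * dw v) / F_den12 kappa s ^+ 3).
    by field.
  by rewrite D3E; ring.
- by rewrite F_den3_stepE in M_neq0 *; field; rewrite exprMn.
Qed.

Lemma Jac_F s : F_dom kappa s ->
  Jac (F gamma kappa) s = (dF_dir s)^T *m dF_form s.
Proof.
move=> /is_diff_F dF; apply: trmx_inj; rewrite trmx_mul !trmxK.
apply/row_matrixP => i; rewrite !rowE -deriveEjacobian // deriveE // diff_val.
rewrite mulmxA [delta_mx 0 i *m _]mx11_scalar mul_scalar_mx; congr (_ *: _).
by rewrite -[in RHS](trmxK (delta_mx 0 i)) -trmx_mul [RHS]mxE.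
Qed.

Lemma JF_formulaE s :
  JF_formula gamma kappa s = (dF_dir s)^T *m dF_form s.
Proof.
have N32E : ((s 0 0 - s 0 2 * kappa * s 0 0) ^+ 2 + (s 0 1 - s 0 2 * s 0 1) ^+ 2)
    `^ (3 / 2) = F_den12 kappa s ^+ 3.
  rewrite (_ : _ ^+ 2 + _ = ustep s ^+ 2 + wstep s ^+ 2); last first.
    by rewrite /ustep /wstep; ring.
  (* The exponent is read as [1/2] times 3, so that the real power becomes the cube of a square
     root. *)
  rewrite (mulrC 3) powRrM powR12_sqrt ?addr_ge0 ?sqr_ge0 //.
  by rewrite powR_mulrn ?sqrtr_ge0 // -F_den12_stepE.
have ME : kappa ^+ 2 * s 0 0 ^+ 2 * (s 0 2 * kappa - 1) ^+ 2
    + (s 0 2 - 1) ^+ 2 * s 0 1 ^+ 2 = F_den3 kappa s by rewrite /F_den3; ring.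
rewrite /JF_formula /= N32E ME /dF_dir.
apply/matrixP => i j; rewrite !mxE big_ord1 !mxE.
by case: i => -[|[|[|//]]] ?; case: j => -[|[|[|//]]] ?; rewrite /= /ustep /wstep;
  ring.
Qed.

End PolyakDifferential.

(** * The period-two orbit and its multiplier *)

Section PeriodTwoOrbit.
Variables (R : realType) (gamma kappa : R).
Hypotheses (gamma_gt0 : 0 < gamma) (gamma_lt4 : gamma < 4) (kappa_gt1 : 1 < kappa).

Let s x y : 'rV[R]_3 := vec3 x y (2 / (kappa + 1)).
Let c : R := (kappa - 1) / (kappa + 1).

Definition orbit_coords (x y : R) : Prop :=
  x ^+ 2 = (gamma * (kappa + 1) - 4) / ((4 - gamma) * (kappa ^+ 2 - 1)) /\
  y ^+ 2 = kappa * (gamma - 4 * kappa + gamma * kappa)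
           / ((gamma - 4) * (kappa ^+ 2 - 1)).

(* The value [v1 *m u2 = v2 *m u1] for the rank-one Jacobians [u1 *m v1] and
   [u2 *m v2] at the two points of an orbit. *)
Definition orbit_multiplier : R :=
  (gamma * (kappa + 1) - 4) * (4 * kappa - gamma - gamma * kappa)
  / (gamma * (kappa - 1) ^+ 2) - 1.

Let kD1_neq0 : kappa + 1 != 0. Proof. by apply: lt0r_neq0; move: kappa_gt1; lra. Qed.
Let kB1_neq0 : kappa - 1 != 0. Proof. by apply: lt0r_neq0; move: kappa_gt1; lra. Qed.
Let k_neq0 : kappa != 0. Proof. by apply: lt0r_neq0; move: kappa_gt1; lra. Qed.
Let g_neq0 : gamma != 0. Proof. exact: lt0r_neq0. Qed.
Let gB4_neq0 : gamma - 4 != 0. Proof. by apply: ltr0_neq0; move: gamma_lt4; lra. Qed.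
Let g4B_neq0 : 4 - gamma != 0. Proof. by apply: lt0r_neq0; move: gamma_lt4; lra. Qed.
Let k2B1_neq0 : kappa ^+ 2 - 1 != 0.
Proof. by rewrite subr_sqr_1 mulf_neq0. Qed.
Let c_gt0 : 0 < c. Proof. by rewrite divr_gt0 //; move: kappa_gt1; lra. Qed.

(** By this symmetry, each fact about one point of an orbit also serves for the other. *)
Lemma orbit_coordsN x y : orbit_coords x y -> orbit_coords (- x) y.
Proof. by rewrite /orbit_coords sqrrN. Qed.

Lemma orbit_coords_norm x y : orbit_coords x y -> x ^+ 2 + y ^+ 2 = 1.
Proof.
by move=> [-> ->]; field; rewrite gB4_neq0 g4B_neq0 k2B1_neq0.
Qed.

Lemma orbit_coords_wnorm x y : orbit_coords x y ->
  kappa ^+ 2 * x ^+ 2 + y ^+ 2 = kappa * gamma / (4 - gamma).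
Proof.
by move=> [-> ->]; field; rewrite gB4_neq0 g4B_neq0 k2B1_neq0.
Qed.

Lemma ustep_orbit x y : ustep kappa (s x y) = - c * x.
Proof. by rewrite /ustep !mxE /= /c; field. Qed.

Lemma wstep_orbit x y : wstep (s x y) = c * y.
Proof. by rewrite /wstep !mxE /= /c; field. Qed.

Lemma F_den12_orbit x y : orbit_coords x y -> F_den12 kappa (s x y) = c.
Proof.
move=> xy; rewrite F_den12_stepE ustep_orbit wstep_orbit.
rewrite (_ : _ + _ = c ^+ 2 * (x ^+ 2 + y ^+ 2)); last by ring.
by rewrite (orbit_coords_norm xy) mulr1 sqrtr_sqr gtr0_norm.
Qed.

Lemma F_den3_orbit x y : orbit_coords x y ->
  F_den3 kappa (s x y) = c ^+ 2 * (kappa * gamma / (4 - gamma)).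
Proof.
move=> xy; rewrite F_den3_stepE ustep_orbit wstep_orbit.
by rewrite -(orbit_coords_wnorm xy); ring.
Qed.

Lemma F_dom_orbit x y : orbit_coords x y -> F_dom kappa (s x y).
Proof.
move=> xy; split; first by rewrite F_den12_orbit // gt_eqF.
rewrite F_den3_orbit // gt_eqF // mulr_gt0 ?exprn_gt0 // divr_gt0 ?mulr_gt0 //.
  by move: kappa_gt1; lra.
by rewrite subr_gt0.
Qed.

Lemma F_orbit x y : orbit_coords x y -> F gamma kappa (s x y) = s (- x) y.
Proof.
move=> xy; have [xE yE] := xy; have c_neq0 : c != 0 by rewrite gt_eqF.
rewrite F_stepE F_den12_orbit // F_den3_orbit // ustep_orbit wstep_orbit.
congr vec3; first by field.
  by field.
(* Here [kappa x^2 + y^2 = 4 kappa / ((4 - gamma) (kappa + 1))], so [gamma / 2] times its ratio to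
   the weighted norm returns [2 / (kappa + 1)]. *)
rewrite (_ : kappa * _ + _ = c ^+ 2 * (kappa * x ^+ 2 + y ^+ 2)); last by ring.
rewrite xE yE /c; field.
by rewrite g_neq0 kB1_neq0 k_neq0 kD1_neq0 gB4_neq0 g4B_neq0 k2B1_neq0.
Qed.

Lemma dF_form_dir_orbit x y : orbit_coords x y ->
  (dF_form kappa (s x y) *m (dF_dir gamma kappa (s (- x) y))^T) 0 0
  = orbit_multiplier.
Proof.
move=> xy; have [xE yE] := xy; have c_neq0 : c != 0 by rewrite gt_eqF.
rewrite mxE sum_ord3 /dF_dir /dF_form.
rewrite F_den12_orbit ?F_den3_orbit; [|exact: orbit_coordsN..].
rewrite !ustep_orbit !wstep_orbit !mxE /=.
(* The first two coordinates contribute [-(x^2 + y^2)], the third the term in [x^2 y^2]. *)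
transitivity ((kappa + 1) ^+ 2 * (4 - gamma) ^+ 2 / (kappa * gamma)
   * (x ^+ 2 * y ^+ 2) - (x ^+ 2 + y ^+ 2)).
  rewrite /c; field.
  by rewrite g_neq0 kB1_neq0 k_neq0 kD1_neq0 g4B_neq0.
rewrite (orbit_coords_norm xy) xE yE /orbit_multiplier; field.
by rewrite g_neq0 kB1_neq0 k_neq0 gB4_neq0 g4B_neq0 k2B1_neq0.
Qed.

(** Both scalar products equal the multiplier, because it does not depend on the sign of [x]; their
    product is a square, so the absolute value disappears. *)
Lemma spectral_radius_orbit s1 s2 : orbits2 gamma kappa (s1, s2) ->
  spectral_radius (Jac (F gamma kappa) s1 *m Jac (F gamma kappa) s2)
  = orbit_multiplier ^+ 2.
Proof.
move=> [x [y [/= -> -> xE yE]]]; have xy : orbit_coords x y by [].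
have xyN := orbit_coordsN xy.
rewrite -/(s x y) -/(s (- x) y).
rewrite !Jac_F; [|exact: F_dom_orbit..].
rewrite -mulmxA spectral_radius_mul_col_row // !mulmxA.
set f1 := dF_form _ (s x y); set d1 := dF_dir _ _ (s x y).
rewrite [f1 *m _]mx11_scalar mul_scalar_mx -scalemxAl mxE.
rewrite dF_form_dir_orbit //; have := dF_form_dir_orbit xyN; rewrite opprK => ->.
by rewrite ger0_norm ?expr2 // -expr2 sqr_ge0.
Qed.

End PeriodTwoOrbit.

(** * Existence of orbits, the Jacobian formula and the two spectral radii under the bounds on
    [gamma] and [kappa] *)

Unset Implicit Arguments.

Theorem proposition3p2 (R : realType) (gamma kappa : R)
    (gamma_gt0 : 0 < gamma) (gamma_le2 : gamma <= 2)
    (kappa_gt : Num.max (4 * gamma^-1 - 1) (3 + 2 * Num.sqrt 2) < kappa) :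
  [/\ orbits2 gamma kappa !=set0,
      forall s1 s2 : 'rV[R]_3, orbits2 gamma kappa (s1, s2) ->
        [/\ s1 <> s2, F_dom kappa s1, F_dom kappa s2,
            F gamma kappa s1 = s2 & F gamma kappa s2 = s1],
      forall s : 'rV[R]_3, F_dom kappa s ->
        differentiable (F gamma kappa) s /\
        Jac (F gamma kappa) s = JF_formula gamma kappa s,
      forall s1 s2 : 'rV[R]_3, orbits2 1 kappa (s1, s2) ->
        spectral_radius (Jac (F 1 kappa) s1 *m Jac (F 1 kappa) s2)
          = 4 * (kappa ^+ 2 - 4 * kappa + 1) ^+ 2 / (kappa - 1) ^+ 4 /\
        1 < 4 * (kappa ^+ 2 - 4 * kappa + 1) ^+ 2 / (kappa - 1) ^+ 4 &
      forall s1 s2 : 'rV[R]_3, orbits2 2 kappa (s1, s2) ->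
        spectral_radius (Jac (F 2 kappa) s1 *m Jac (F 2 kappa) s2) = 1].
Proof.
move: kappa_gt; rewrite gt_max => /andP[kappa_gtg kappa_gt_sqrt].
have gk_gt4 : 4 < gamma * (kappa + 1).
  by rewrite mulrC -ltr_pdivrMr // -ltrBlDr.
have sqrt2_ge0 := sqrtr_ge0 (2 : R).
have sqrt2_sqr : Num.sqrt 2 ^+ 2 = 2 :> R by rewrite sqr_sqrtr.
have kappa_gt1 : 1 < kappa by lra.
have gamma_lt4 : gamma < 4 by lra.
have kB1_neq0 : kappa - 1 != 0 by apply: lt0r_neq0; lra.
(* Positivity allows a real [x] and, being strict, separates the two points of an orbit. *)
have x2_gt0 : 0 < (gamma * (kappa + 1) - 4) / ((4 - gamma) * (kappa ^+ 2 - 1)).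
  by rewrite divr_gt0 ?mulr_gt0 ?subr_gt0 // exprn_egt1.
split.
- have y2_ge0 : 0 <= kappa * (gamma - 4 * kappa + gamma * kappa)
                   / ((gamma - 4) * (kappa ^+ 2 - 1)).
    have k2 : 0 < kappa ^+ 2 - 1 by rewrite subr_gt0 exprn_egt1.
    (* Numerator and denominator are both nonpositive: [gamma (1 + kappa) <= 2 (1 + kappa) < 4
       kappa], and [gamma < 4]. *)
    rewrite mulr_le0 //; first by nra.
    by rewrite invr_le0; nra.
  set x2 := _ / _ in x2_gt0; set y2 := _ / _ in y2_ge0.
  exists (vec3 (Num.sqrt x2) (Num.sqrt y2) (2 / (kappa + 1)),
          vec3 (- Num.sqrt x2) (Num.sqrt y2) (2 / (kappa + 1))).
  by exists (Num.sqrt x2), (Num.sqrt y2); split; rewrite ?sqr_sqrtr // ltW.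
- move=> s1 s2 [x [y [/= -> -> xE yE]]].
  have xy : orbit_coords gamma kappa x y by [].
  have xyN := orbit_coordsN xy.
  split; [|exact: F_dom_orbit xy|exact: F_dom_orbit xyN|exact: F_orbit|].
    move=> /rowP/(_ 0); rewrite !mxE /= => xNx.
    have x0 : x = 0 by lra.
    by move: x2_gt0; rewrite -xE x0 expr0n ltxx.
  by rewrite F_orbit // opprK.
- move=> s sdom; rewrite JF_formulaE Jac_F //; split=> //.
  by have := is_diff_F gamma sdom.
- move=> s1 s2 s12; rewrite (spectral_radius_orbit _ _ _ s12) //; last by lra.
  split; first by rewrite /orbit_multiplier; field.
  rewrite ltr_pdivlMr ?mul1r; last by rewrite exprn_gt0 //; lra.
  (* The larger root of this quadratic is [3 + 2 sqrt 2]. It equals [2 (kappa^2 - 4 kappa + 1) -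
     (kappa - 1)^2], so its positivity says that the multiplier exceeds 1; squaring concludes. *)
  have q_gt0 : 0 < kappa ^+ 2 - 6 * kappa + 1 by nra.
  have : (kappa - 1) ^+ 2 < 2 * (kappa ^+ 2 - 4 * kappa + 1) by nra.
  rewrite -(ltr_pXn2r (_ : 0 < 2)%N) ?nnegrE ?sqr_ge0 //; last by nra.
  by rewrite -exprM exprMn -natrX.
- move=> s1 s2 s12; rewrite (spectral_radius_orbit _ _ _ s12) //; last by lra.
  (* At [gamma = 2] both factors of the numerator are [2 (kappa - 1)], so the multiplier is
     [2 - 1]. *)
  by rewrite /orbit_multiplier; field.
Qed.
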